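(* Let $\mathcal{T}$ be an $l$-eligible microdata table. The three-phase algorithm described in the context (with arbitrary tie-breaking) terminates with remaining groups $\hat{Q}_1,\dots,\hat{Q}_s$ and residue set $\hat{R}$ forming a feasible solution of the reformulated tuple minimization problem with $|\hat{R}| \le l\cdot OPT$; i.e., it is an $l$-approximation algorithm for tuple minimization.
   Context: A microdata table $\mathcal{T}$ is a multiset of $n$ tuples with values on $d$ quasi-identifier (QI) attributes and one sensitive attribute (SA). For a multiset $Q$ and SA value $v$, $h(Q,v)$ is the number of tuples in $Q$ with SA value $v$, $h(Q)=\max_v h(Q,v)$, pillars of $Q$ are the $v$ with $h(Q,v)=h(Q)$; $Q$ is $l$-eligible if $|Q|\ge l\cdot h(Q)$. Let $Q_1,\dots,Q_s$ be the maximal classes of tuples of $\mathcal{T}$ with identical values on all QI attributes. Reformulated tuple minimization: choose sub-multisets $Q'_i\subseteq Q_i$ and $R'=\mathcal{T}\setminus\bigcup_i Q'_i$ with all $Q'_i$ and $R'$ $l$-eligible, minimizing $|R'|$ (the tuples of $R'$ are the suppressed ones); $OPT$ is the minimum. The algorithm only moves tuples from the groups into a residue set $R$ (initially empty), and terminates as soon as $R$ becomes $l$-eligible. Terminology (w.r.t. current state): a group $Q$ is thin if $|Q|=l\cdot h(Q)$, fat if $|Q|\ge l\cdot h(Q)+1$; conflicting if some pillar of $Q$ is a pillar of $R$ (its conflicting pillars, set $C(Q)$); dead if thin and conflicting, alive otherwise; an SA value $v$ is alive if some alive group $Q$ has $h(Q,v)>0$. Phase One: for each $i$, while $Q_i$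 is not $l$-eligible, move a tuple of a pillar of $Q_i$ to $R$. Phase Two: repeat: if no SA value is alive, go to Phase Three; else pick an alive SA value $v$ minimizing $h(R,v)$ and an alive group $Q$ with $h(Q,v)>0$; if $Q$ is fat move one tuple with SA value $v$ to $R$, if thin move one tuple of each pillar of $Q$ to $R$. Phase Three proceeds in rounds. Step 1: let $P$ be the set of pillars of $R$ and $S=\emptyset$; while $P\ne\emptyset$, pick a group $Q$ minimizing $|C(Q)\cap P|$, add it to $S$, and set $P\leftarrow P\cap C(Q)$; then for each $Q\in S$ move one tuple of each pillar of $Q$ to $R$. Step 2: for each group $Q$ that is now alive, repeat until $Q$ is dead: if $Q$ is fat, move to $R$ a tuple of $Q$ whose SA value is not a pillar of $R$; if $Q$ is thin and non-conflicting, move one tuple of each pillar of $Q$ to $R$. All ties are broken arbitrarily. *)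

(* Defs.v *)
From mathcomp Require Import all_boot.
Set Implicit Arguments. Unset Strict Implicit. Unset Printing Implicit Defensive.

Section Anon.
Variables (Q V : eqType) (l : nat) (T : seq (Q * V)).

(** Multisets of SA values are sequences (order irrelevant). *)
Definition hv (s : seq V) (v : V) : nat := count_mem v s.
Definition h (s : seq V) : nat := \max_(v <- s) hv s v.
Definition pillar (s : seq V) (v : V) : bool := hv s v == h s.
Definition eligible (s : seq V) : bool := l * h s <= size s.
Definition thin (s : seq V) : bool := size s == l * h s.
Definition fat (s : seq V) : bool := l * h s + 1 <= size s.
Definition pillars (s : seq V) : seq V := [seq v <- undup s | pillar s v].

(** The QI classes Q_1..Q_s, indexed by their QI value, and their
    initial contents (SA values). *)
Definition classes : seq Q := undup (map fst T).
Definition group0 (q : Q) : seq V := [seq x.2 | x <- T & x.1 == q].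

Inductive control :=
| Phase1
| Phase2
| Phase3Start
| Phase3Greedy of seq V & seq Q        (* Step 1 loop: current P and S *)
| Phase3Move of seq Q                  (* Step 1 moves still to perform *)
| Phase3Step2 of seq Q                 (* Step 2: groups still to process *)
| Done.

Record state := St { grp : Q -> seq V; res : seq (Q * V); ctl : control }.

Definition init : state := St group0 [::] Phase1.

Definition Rsa (st : state) : seq V := map snd (res st).

Definition upd (g : Q -> seq V) (q : Q) (s : seq V) : Q -> seq V :=
  fun x => if x == q then s else g x.

Definition move1 (st : state) (q : Q) (v : V) (c : control) : state :=
  St (upd (grp st) q (rem v (grp st q))) ((q, v) :: res st) c.

Definition movep (st : state) (q : Q) (c : control) : state :=
  let ps := pillars (grp st q) in
  St (upd (grp st) q (foldl (fun s v => rem v s) (grp st q) ps))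
     ([seq (q, v) | v <- ps] ++ res st) c.

Definition conflicting (st : state) (q : Q) : Prop :=
  exists v, pillar (grp st q) v /\ pillar (Rsa st) v.
Definition dead (st : state) (q : Q) : Prop :=
  thin (grp st q) /\ conflicting st q.
Definition alive (st : state) (q : Q) : Prop := ~ dead st q.
Definition alive_val (st : state) (v : V) : Prop :=
  exists2 q, q \in classes & alive st q /\ 0 < hv (grp st q) v.
Definition CP (st : state) (q : Q) (P : seq V) : seq V :=
  [seq v <- P | pillar (grp st q) v && pillar (Rsa st) v].
Definition Rpillars (st : state) : seq V :=
  [seq v <- undup (Rsa st) | pillar (Rsa st) v].

(** One atomic step of the algorithm; all tie-breaking is nondeterministic. *)
Inductive step : state -> state -> Prop :=
| s_p1_move st q v :
    ctl st = Phase1 -> q \in classes -> ~~ eligible (grp st q) ->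
    v \in grp st q -> pillar (grp st q) v ->
    step st (move1 st q v Phase1)
| s_p1_end st :
    ctl st = Phase1 -> (forall q, q \in classes -> eligible (grp st q)) ->
    step st (St (grp st) (res st) Phase2)
| s_done st :
    ctl st <> Phase1 -> ctl st <> Done -> eligible (Rsa st) ->
    step st (St (grp st) (res st) Done)
| s_p2_fat st v q :
    ctl st = Phase2 -> ~~ eligible (Rsa st) ->
    alive_val st v -> (forall w, alive_val st w -> hv (Rsa st) v <= hv (Rsa st) w) ->
    q \in classes -> alive st q -> 0 < hv (grp st q) v ->
    fat (grp st q) ->
    step st (move1 st q v Phase2)
| s_p2_thin st v q :
    ctl st = Phase2 -> ~~ eligible (Rsa st) ->
    alive_val st v -> (forall w, alive_val st w -> hv (Rsa st) v <= hv (Rsa st) w) ->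
    q \in classes -> alive st q -> 0 < hv (grp st q) v ->
    thin (grp st q) ->
    step st (movep st q Phase2)
| s_p2_end st :
    ctl st = Phase2 -> ~~ eligible (Rsa st) ->
    (forall v, ~ alive_val st v) ->
    step st (St (grp st) (res st) Phase3Start)
| s_p3_start st :
    ctl st = Phase3Start -> ~~ eligible (Rsa st) ->
    step st (St (grp st) (res st) (Phase3Greedy (Rpillars st) [::]))
| s_p3_greedy st P S q :
    ctl st = Phase3Greedy P S -> ~~ eligible (Rsa st) -> P != [::] ->
    q \in classes ->
    (forall q', q' \in classes -> size (CP st q P) <= size (CP st q' P)) ->
    step st (St (grp st) (res st) (Phase3Greedy (CP st q P) (q :: S)))
| s_p3_greedy_end st S S' :
    ctl st = Phase3Greedy [::] S -> ~~ eligible (Rsa st) ->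
    perm_eq S' (undup S) ->
    step st (St (grp st) (res st) (Phase3Move S'))
| s_p3_move st q S :
    ctl st = Phase3Move (q :: S) -> ~~ eligible (Rsa st) ->
    step st (movep st q (Phase3Move S))
| s_p3_step2 st A :
    ctl st = Phase3Move [::] -> ~~ eligible (Rsa st) ->
    uniq A -> (forall q, q \in A <-> (q \in classes /\ alive st q)) ->
    step st (St (grp st) (res st) (Phase3Step2 A))
| s_p3_fat st q A v :
    ctl st = Phase3Step2 (q :: A) -> ~~ eligible (Rsa st) ->
    alive st q -> fat (grp st q) -> v \in grp st q -> ~~ pillar (Rsa st) v ->
    step st (move1 st q v (Phase3Step2 (q :: A)))
| s_p3_thin st q A :
    ctl st = Phase3Step2 (q :: A) -> ~~ eligible (Rsa st) ->
    alive st q -> thin (grp st q) -> ~ conflicting st q ->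
    step st (movep st q (Phase3Step2 (q :: A)))
| s_p3_next st q A :
    ctl st = Phase3Step2 (q :: A) -> ~~ eligible (Rsa st) ->
    dead st q ->
    step st (St (grp st) (res st) (Phase3Step2 A))
| s_p3_round st :
    ctl st = Phase3Step2 [::] -> ~~ eligible (Rsa st) ->
    step st (St (grp st) (res st) Phase3Start).

Inductive reachable : state -> Prop :=
| r_init : reachable init
| r_step st st' : reachable st -> step st st' -> reachable st'.

(** Feasible solution of the reformulated tuple minimization problem:
    sub-multisets g q of the classes and residue R' = T minus their union,
    all l-eligible. *)
Definition feasible (g : Q -> seq V) (R' : seq (Q * V)) : Prop :=
  perm_eq T (R' ++ flatten [seq [seq (q, v) | v <- g q] | q <- classes]) /\
  (forall q, q \in classes -> eligible (g q)) /\
  eligible (map snd R').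

End Anon.

(* Main.v *)
Require Import Defs.
From mathcomp Require Import all_boot zify.
Set Implicit Arguments. Unset Strict Implicit. Unset Printing Implicit Defensive.

(** Phase One keeps, in every class, at least as many copies of each value as
    any l-eligible sub-multiset does, so if [m] is the height of R after Phase
    One, then [l * m <= OPT]. Phase Two does not raise h(R): an ineligible R has
    fewer than [l] pillars, while an eligible nonempty group has at least [l]
    values, so a least frequent alive value is never a pillar of R.

    For Phase Three, take the potential h(R) + sum_Q h(Q). Step 1 lowers the sum
    by |S| and raises h(R) by at most |S| - 1, because no pillar of R is a pillar
    of every group of S; Step 2 raises neither. So each round costs at least one
    unit. When all groups are dead, |T| = |R| + l * sum_Q h(Q), and R is
    ineligible exactly when [l] times the potential exceeds |T|; hence there are
    at most [m] rounds. Since T is eligible, no pillar of R is a pillar of all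
    groups, so each greedy choice shrinks P and |S| <= l - 1: a round raises h(R)
    by at most [l - 2]. Thus h(R) <= (l - 1) * m at all times, and as one move
    takes at most [l] tuples, the final R has at most [l * (l * m) <= l * OPT]. *)

(** * Minima and counts over sequences *)

Lemma seq_argmin (I : eqType) (s : seq I) (f : I -> nat) :
  s != [::] -> exists2 x, x \in s & forall y, y \in s -> f x <= f y.
Proof.
elim: s => [//|x [|y s] IHs] _.
  by exists x; rewrite ?mem_head // => z; rewrite inE => /eqP ->.
have [z z_s z_min] := IHs isT.
have [le_xz|/ltnW le_zx] := leqP (f x) (f z).
  exists x; rewrite ?mem_head // => t; rewrite inE => /predU1P[-> //|/z_min].
  exact: leq_trans.
exists z; first by rewrite inE z_s orbT.
by move=> t; rewrite inE => /predU1P[-> //|/z_min].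
Qed.

Lemma sum_count_undup (I : eqType) (s : seq I) :
  \sum_(v <- undup s) count_mem v s = size s.
Proof.
rewrite -[RHS](perm_size (perm_count_undup s)) size_flatten /shape sumnE.
by rewrite !big_map; apply: eq_bigr => v _; rewrite size_nseq.
Qed.

Lemma leq_size_counts (I : eqType) (s t : seq I) :
  (forall x, count_mem x s <= count_mem x t) -> size s <= size t.
Proof.
move=> le_st; rewrite -!sum1_size; apply: (@sub_le_big_seq _ _ leq) => //.
by move=> m n; apply: leq_addr.
Qed.

(** * Heights, pillars and eligibility of a multiset *)

Section Height.
Variable V : eqType.
Implicit Types (s t : seq V) (v w : V) (l n : nat).

Lemma leq_hv_h s v : hv s v <= h s.
Proof.
have [v_s|/count_memPn v_s] := boolP (v \in s); last by rewrite /hv v_s.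
exact: (@leq_bigmax_seq _ s xpredT (hv s)).
Qed.

Lemma h_leqP s n : reflect (forall v, hv s v <= n) (h s <= n).
Proof.
apply: (iffP idP) => [le_n v|le_n]; first exact: leq_trans (leq_hv_h s v) le_n.
by apply/bigmax_leqP_seq => v _ _; apply: le_n.
Qed.

Lemma h_leq_size s : h s <= size s.
Proof. by apply/h_leqP => v; apply: count_size. Qed.

Lemma hv_gt0 s v : (0 < hv s v) = (v \in s).
Proof. by rewrite /hv -has_count has_pred1. Qed.

Lemma h_gt0 s : (0 < h s) = (s != [::]).
Proof.
apply/idP/idP => [|s_n0]; first by case: s => [|//]; rewrite /h big_nil.
have [x x_s] : exists x, x \in s
  by case: s s_n0 => [//|x s]; exists x; rewrite mem_head.
by apply: leq_trans (leq_hv_h s x); rewrite hv_gt0.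
Qed.

Lemma pillar_mem s v : 0 < h s -> pillar s v -> v \in s.
Proof. by move=> h_gt /eqP hv_eq; rewrite -hv_gt0 hv_eq. Qed.

Lemma pillar_nil v : pillar [::] v.
Proof. by rewrite /pillar /h big_nil. Qed.

Lemma pillarPn s v : reflect (hv s v < h s) (~~ pillar s v).
Proof. by rewrite /pillar ltn_neqAle leq_hv_h andbT; apply: idP. Qed.

Lemma pillar_exists s : 0 < h s -> exists2 v, v \in s & pillar s v.
Proof.
move=> h_gt; have [//|no_pillar] := boolP (has (pillar s) s).
  by move/hasP=> [v]; exists v.
suff : h s <= (h s).-1 by lia.
apply/h_leqP => v; have [v_s|/count_memPn] := boolP (v \in s);
  last by rewrite /hv => ->.
by move/hasPn: no_pillar => /(_ _ v_s)/pillarPn; lia.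
Qed.

Lemma mem_pillars s v : (v \in pillars s) = (v \in s) && pillar s v.
Proof. by rewrite mem_filter mem_undup andbC. Qed.

Lemma pillars_uniq s : uniq (pillars s).
Proof. by rewrite filter_uniq ?undup_uniq. Qed.

Lemma size_pillars_mul s : size (pillars s) * h s <= size s.
Proof.
rewrite -[leqRHS]sum_count_undup (bigID (pillar s)) /= -big_filter -/(pillars s).
rewrite (eq_big_seq (fun=> h s)) => [|v].
  by rewrite big_const_seq count_predT iter_addn_0 mulnC leq_addr.
by rewrite mem_filter => /andP[/eqP].
Qed.

Lemma size_pillars_gt0 s : (0 < size (pillars s)) = (s != [::]).
Proof.
rewrite -h_gt0; apply/idP/idP => [|/pillar_exists[v v_s pil_v]].
  by rewrite h_gt0; case: s.
have : v \in pillars s by rewrite mem_pillars v_s.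
by case: (pillars s).
Qed.

Lemma size_leq_mul_h s t : {subset s <= t} -> size s <= size t * h s.
Proof.
move=> sub_st; rewrite -[leqLHS]sum_count_undup.
apply: (@leq_trans (\sum_(v <- undup s) h s)).
  by apply: leq_sum => v _; apply: leq_hv_h.
rewrite big_const_seq count_predT iter_addn_0 mulnC leq_mul2r.
by rewrite uniq_leq_size ?undup_uniq ?orbT // => v; rewrite mem_undup; apply: sub_st.
Qed.

(** Were every value of [s] in [t], then [size s <= size t * h s < l * h s]. It is applied with [t]
    the pillars of an ineligible R. *)
Lemma eligible_notin l s t : eligible l s -> s != [::] -> size t < l ->
  exists2 v, v \in s & v \notin t.
Proof.
move=> el_s; rewrite -h_gt0 => h_gt lt_tl; apply/hasP.
rewrite has_predC; apply/negP => /allP sub_st.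
have := size_leq_mul_h sub_st; rewrite leqNgt (@leq_trans (l * h s)) //.
by rewrite ltn_pmul2r.
Qed.

(** With [l] pillars, each of multiplicity [h s], there would be at least [l * h s] elements. *)
Lemma ineligible_pillars l s : ~~ eligible l s -> size (pillars s) < l.
Proof.
rewrite /eligible -ltnNge => lt_s.
have h_gt : 0 < h s by rewrite lt0n; apply: contraTneq lt_s => ->; rewrite muln0.
by rewrite -(ltn_pmul2r h_gt) (leq_ltn_trans (size_pillars_mul s)).
Qed.

(** For [l <= 1] every multiset is eligible, because [h s <= size s]. This is what makes the
    truncated [l - 1] and [l - 2] below genuine differences. *)
Lemma ineligible_gt1 l s : ~~ eligible l s -> 1 < l.
Proof.
by apply: contraR; case: l => [|[|//]] _; rewrite /eligible ?mul1n ?h_leq_size.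
Qed.

Lemma ineligible_h_gt0 l s : ~~ eligible l s -> 0 < h s.
Proof. by apply: contraR; rewrite -eqn0Ngt /eligible => /eqP->; rewrite muln0. Qed.

Lemma thin_pillars l s : thin l s -> 0 < h s -> size (pillars s) <= l.
Proof.
by move=> /eqP thin_s h_gt; rewrite -(leq_pmul2r h_gt) -thin_s size_pillars_mul.
Qed.

Lemma hv_rem s v w : hv (rem v s) w = hv s w - (v == w).
Proof. exact: count_mem_rem. Qed.

Lemma h_rem s v : h (rem v s) <= h s.
Proof. by apply/h_leqP => w; rewrite hv_rem (leq_trans (leq_subr _ _)) ?leq_hv_h. Qed.

Lemma fat_rem l s v : fat l s -> v \in s -> eligible l (rem v s).
Proof.
rewrite /fat addn1 => fat_s v_s; rewrite /eligible size_rem // (@leq_trans (l * h s)) //.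
  by rewrite leq_mul2l h_rem orbT.
by lia.
Qed.

Lemma eligible_thin_fat l s : eligible l s -> thin l s || fat l s.
Proof. by rewrite /eligible /thin /fat leq_eqVlt addn1 eq_sym. Qed.

(** What [movep] leaves of a group; the fold is the same, so the two agree by conversion. *)
Definition strip s := foldl (fun t v => rem v t) s (pillars s).

Lemma hv_strip s w : hv (strip s) w = hv s w - (w \in pillars s).
Proof.
rewrite -(count_uniq_mem _ (pillars_uniq s)) /strip.
elim: (pillars s) {1 3}s => [|v p IHp] t /=; first by rewrite subn0.
by rewrite IHp hv_rem subnDA.
Qed.

Lemma hv_strip_addn s w : hv (strip s) w + (w \in pillars s) = hv s w.
Proof.
rewrite hv_strip subnK //; case: (boolP (w \in _)) => //.
by rewrite mem_pillars => /andP[+ _]; rewrite -hv_gt0.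
Qed.

Lemma size_strip s : size (strip s) + size (pillars s) = size s.
Proof.
rewrite -size_cat; apply/perm_size/allP => v _ /=; rewrite count_cat.
by rewrite (count_uniq_mem _ (pillars_uniq s)) -/(hv _ v) hv_strip_addn.
Qed.

Lemma h_strip s : 0 < h s -> h (strip s) < h s.
Proof.
move=> h_gt; rewrite -[X in _ < X]prednK // ltnS; apply/h_leqP => w.
have [pil_w|/pillarPn] := boolP (pillar s w); rewrite hv_strip; last by lia.
by rewrite mem_pillars pil_w (pillar_mem h_gt) // (eqP pil_w) subn1.
Qed.

(** A thin multiset of positive height has at most [l] pillars, so its size drops by at most [l]
    while its height drops by at least one. *)
Lemma eligible_strip l s : thin l s -> eligible l (strip s).
Proof.
move=> thin_s; have [h0|h_gt] := posnP (h s).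
  rewrite /eligible; have : h (strip s) <= 0.
    by apply/h_leqP => w; rewrite hv_strip (leq_trans (leq_subr _ _)) // -h0 leq_hv_h.
  by rewrite leqn0 => /eqP ->; rewrite muln0.
have := size_strip s; have := thin_pillars thin_s h_gt; have := h_strip h_gt.
by move: thin_s; rewrite /thin /eligible => /eqP; nia.
Qed.

End Height.

Lemma hv_cat (V : eqType) (s t : seq V) v : hv (s ++ t) v = hv s v + hv t v.
Proof. exact: count_cat. Qed.

(** A nonpillar has multiplicity below [h s], and a duplicate-free [p] adds at most one copy of it.
    Hence moves in Phase Two and in Step 2 leave h(R) unchanged. *)
Lemma h_cat_nonpillars (V : eqType) (p s : seq V) :
  uniq p -> {in p, forall v, ~~ pillar s v} -> h (p ++ s) = h s.
Proof.
move=> uniq_p p_nonpil; apply/eqP; rewrite eqn_leq; apply/andP; split.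
  apply/h_leqP => w; rewrite hv_cat [hv p w](count_uniq_mem _ uniq_p).
  have [/p_nonpil/pillarPn //|_] := boolP (w \in p).
  by rewrite leq_hv_h.
by apply/h_leqP => w; rewrite (leq_trans _ (leq_hv_h _ w)) // hv_cat leq_addl.
Qed.

Lemma leq_size_h (V : eqType) (s t : seq V) :
  (forall v, hv s v <= hv t v) -> h s <= h t.
Proof.
by move=> le_st; apply/h_leqP => v; apply: leq_trans (le_st v) (leq_hv_h _ _).
Qed.

Lemma count_flatten_tag (Q V : eqType) (g : Q -> seq V) (cs : seq Q) q v :
  uniq cs ->
  count_mem (q, v) (flatten [seq [seq (q', v') | v' <- g q'] | q' <- cs])
    = (q \in cs) * hv (g q) v.
Proof.
elim: cs => [//|c cs IHcs] /= /andP[c_cs /IHcs IH].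
rewrite count_cat IH count_map inE [q == c]eq_sym.
have [<-|ne_cq] /= := eqVneq c q.
  rewrite (negPf c_cs) mul0n addn0 mul1n; apply: eq_count => w /=.
  by rewrite xpair_eqE eqxx.
rewrite (eq_count (a2 := pred0)) ?count_pred0 // => w /=.
by rewrite xpair_eqE (negPf ne_cq).
Qed.

(** * Conservation of tuples, and dead groups *)

Section Conservation.
Variables (Q V : eqType) (l : nat) (T : seq (Q * V)).
Implicit Types (st : state Q V) (q : Q) (v w : V) (c : control Q V).

Lemma hv_group0 q v : hv (group0 T q) v = count_mem (q, v) T.
Proof.
rewrite /hv /group0 count_map count_filter; apply: eq_count => -[q' v'] /=.
by rewrite xpair_eqE andbC.
Qed.

Lemma classes_uniq : uniq (classes T).
Proof. exact: undup_uniq. Qed.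

Lemma count_notin_classes q v : q \notin classes T -> count_mem (q, v) T = 0.
Proof.
rewrite mem_undup => q_T; apply/count_memPn; apply: contra q_T => qv_T.
by apply/mapP; exists (q, v).
Qed.

Lemma feasible_count g R' q v : feasible l T g R' ->
  count_mem (q, v) T = count_mem (q, v) R' + (q \in classes T) * hv (g q) v.
Proof.
by move=> [/permP-> _]; rewrite count_cat count_flatten_tag ?classes_uniq.
Qed.

(** Ranging over every [q], not only over [classes T], also forces the groups outside [classes T] to
    be empty. *)
Definition conserved st := forall q v,
  hv (grp st q) v + count_mem (q, v) (res st) = count_mem (q, v) T.

Lemma conserved_grp_nil st q : conserved st -> q \notin classes T ->
  grp st q = [::].
Proof.
move=> cons_st q_T; apply/eqP; rewrite -[_ == _]negbK -h_gt0 -leqNgt.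
apply/h_leqP => v; rewrite -(count_notin_classes v q_T) -(cons_st q v).
exact: leq_addr.
Qed.

Lemma conserved_perm st : conserved st ->
  perm_eq T (res st ++ flatten [seq [seq (q, v) | v <- grp st q] | q <- classes T]).
Proof.
move=> cons_st; apply/allP => -[q v] _ /=; apply/eqP.
rewrite count_cat count_flatten_tag ?classes_uniq // -cons_st addnC.
have [_|q_T] := boolP (q \in _); first by rewrite mul1n.
by rewrite (conserved_grp_nil cons_st q_T).
Qed.

Lemma conserved_size_res st : conserved st -> size (res st) <= size T.
Proof.
move=> cons_st; apply: leq_size_counts => -[q v].
by rewrite -cons_st leq_addl.
Qed.

Lemma conserved_hv st v : conserved st ->
  hv (map snd T) v = hv (Rsa st) v + \sum_(q <- classes T) hv (grp st q) v.
Proof.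
move=> /conserved_perm/(perm_map snd)/permP/(_ (pred1 v)) eq_T.
rewrite /hv eq_T map_cat count_cat map_flatten count_flatten sumnE !big_map.
congr (_ + _); apply: eq_bigr => q _; rewrite -map_comp count_map.
exact: eq_count.
Qed.

Lemma conserved_size st : conserved st ->
  size T = size (Rsa st) + \sum_(q <- classes T) size (grp st q).
Proof.
move=> /conserved_perm/perm_size->; rewrite size_cat size_map; congr (_ + _).
rewrite size_flatten sumnE !big_map; apply: eq_bigr => q _.
by rewrite size_map.
Qed.

Lemma conserved_init : conserved (init T).
Proof. by move=> q v; rewrite /= hv_group0 addn0. Qed.

Lemma conserved_move1 st q v c : conserved st -> v \in grp st q ->
  conserved (move1 st q v c).
Proof.
move=> cons_st v_q q' w; rewrite -cons_st /= /upd xpair_eqE [q == q']eq_sym.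
have [->|_] //= := eqVneq q' q; rewrite hv_rem.
by case: eqP => [<-|_] /=; move: v_q; rewrite -hv_gt0; lia.
Qed.

Lemma conserved_movep st q c : conserved st -> conserved (movep st q c).
Proof.
move=> cons_st q' w; rewrite -cons_st /= /upd count_cat count_map addnA.
congr (_ + _); have [->|ne_q] := eqVneq q' q.
  rewrite -/(strip _) -[RHS]hv_strip_addn; congr (_ + _).
  rewrite -(count_uniq_mem _ (pillars_uniq _)); apply: eq_count => u /=.
  by rewrite xpair_eqE eqxx.
rewrite (eq_count (a2 := pred0)) ?count_pred0 ?addn0 // => u /=.
by rewrite xpair_eqE eq_sym (negPf ne_q).
Qed.

Lemma Rsa_movep st q c : Rsa (movep st q c) = pillars (grp st q) ++ Rsa st.
Proof. by rewrite /Rsa map_cat -map_comp map_id_in. Qed.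

Lemma sum_upd (F : seq V -> nat) st q s : q \in classes T ->
  \sum_(q' <- classes T) F (upd (grp st) q s q') + F (grp st q)
    = \sum_(q' <- classes T) F (grp st q') + F s.
Proof.
move=> q_T; rewrite !(bigD1_seq q) ?classes_uniq //= /upd eqxx.
rewrite addnAC [RHS]addnC addnA; congr (_ + _).
by apply: eq_bigr => q' /negPf->.
Qed.

Definition heights st := \sum_(q <- classes T) h (grp st q).

Lemma heights_upd st st' q s : q \in classes T ->
  grp st' = upd (grp st) q s -> heights st' + h (grp st q) = heights st + h s.
Proof. by move=> q_T eq_g; rewrite /heights eq_g sum_upd. Qed.

(** The pillars of a nonempty R occur in R, so the existential over [V] becomes a finite search;
    this makes deadness decidable. *)
Lemma conflictingP st q : 0 < h (Rsa st) ->
  reflect (conflicting st q) (has (pillar (grp st q)) (Rpillars st)).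
Proof.
move=> R_gt; apply: (iffP hasP) => [[v]|[v [pil_g pil_R]]].
  by rewrite mem_filter => /andP[pil_R _] pil_g; exists v.
by exists v => //; rewrite mem_filter pil_R mem_undup pillar_mem.
Qed.

Lemma dead_dec st q : 0 < h (Rsa st) -> decidable (dead l st q).
Proof.
move=> R_gt; have [thin_q|fat_q] := boolP (thin l (grp st q)); last first.
  by right=> -[thin_q _]; rewrite thin_q in fat_q.
by case: (conflictingP q R_gt) => confl; [left | right => -[_]].
Qed.

(** Every value is a pillar of the empty multiset, so an empty group conflicts with any pillar of R.
    Alive groups are therefore nonempty. *)
Lemma dead_nil st q : 0 < h (Rsa st) -> grp st q = [::] -> dead l st q.
Proof.
move=> /pillar_exists[v _ pil_v] q_nil; split.
  by rewrite /thin q_nil /h big_nil muln0.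
by exists v; rewrite q_nil pillar_nil.
Qed.

(** With h(R) fixed and no multiplicity in R falling, a pillar of R stays a pillar, so the conflict
    survives. *)
Lemma dead_persists st st' q :
  grp st' q = grp st q -> h (Rsa st') = h (Rsa st) ->
  (forall v, hv (Rsa st) v <= hv (Rsa st') v) -> dead l st q -> dead l st' q.
Proof.
move=> eq_g eq_h le_hv [thin_q [v [pil_g pil_R]]]; rewrite /dead eq_g; split=> //.
exists v; rewrite eq_g; split=> //; rewrite /pillar eqn_leq leq_hv_h /=.
by rewrite eq_h -(eqP pil_R).
Qed.

End Conservation.

(** * The invariant of a run *)

Section Invariant.
Variables (Q V : eqType) (l : nat) (T : seq (Q * V)).
Implicit Types (st : state Q V) (q : Q) (v w : V) (c : control Q V).
Implicit Types (m r : nat) (P : seq V) (S A : seq Q).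

Definition all_eligible st := forall q, eligible l (grp st q).

Definition approx st :=
  forall g R', feasible l T g R' -> size (res st) <= l * size R'.

Definition lower_bound m := forall g R', feasible l T g R' -> l * m <= size R'.

(** The first clause says that [l] is positive unless R is empty; at the end of the phase it turns
    |R| <= |R'| into the bound with factor [l]. *)
Definition phase1_inv st :=
  size (res st) <= l * size (res st) /\
  forall q s, eligible l s -> (forall v, hv s v <= count_mem (q, v) T) ->
    forall v, hv s v <= hv (grp st q) v.

(* Here [r] is the number of completed rounds of Phase Three. *)
Definition level m r st :=
  h (Rsa st) <= m + (l - 2) * r /\
  l * (h (Rsa st) + heights T st + r) <= l * m + size T.

Definition dead_off st A := forall q, q \in classes T -> q \notin A -> dead l st q.

(** The size clause yields |S| <= l - 1. The last clause says that a pillar of R leaves [P] only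
    when a chosen group fails to have it as a pillar. *)
Definition greedy_inv st P S :=
  [/\ {subset P <= Rpillars st}, size S + size P < l,
      {in S, forall q, q \in classes T /\ grp st q != [::]} &
      forall w, pillar (Rsa st) w ->
        w \in P \/ exists2 q, q \in S & ~~ pillar (grp st q) w].

(* Here [b] bounds h(R) once all the pending moves of Step 1 are done. *)
Definition move_inv m st S := exists b r,
  [/\ r < m, b <= m + (l - 2) * r.+1,
      l * (b + heights T st + r.+1) <= l * m + size T + l * size S,
      uniq S /\
        {in S, forall q, [/\ q \in classes T, grp st q != [::] & thin l (grp st q)]} &
      forall w, hv (Rsa st) w + count (fun q => pillar (grp st q) w) S <= b].

Definition late_inv m st :=
  match ctl st with
  | Phase1 => False
  | Phase2 => h (Rsa st) <= m
  | Phase3Start => (exists2 r, r <= m & level m r st) /\ dead_off st [::]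
  | Phase3Greedy P G =>
      [/\ exists2 r, r < m & level m r st, dead_off st [::] & greedy_inv st P G]
  | Phase3Move G => move_inv m st G
  | Phase3Step2 A =>
      [/\ exists2 r, r <= m & level m r st, {subset A <= classes T} & dead_off st A]
  | Done => eligible l (Rsa st)
  end.

Definition run_inv st :=
  conserved T st /\
  if ctl st is Phase1 then phase1_inv st
  else [/\ all_eligible st, approx st & exists2 m, lower_bound m & late_inv m st].

(** * Phase One *)

Lemma inv_init : run_inv (init T).
Proof.
split; first exact: conserved_init.
by split=> // q s _ le_s v; rewrite hv_group0.
Qed.

Lemma phase1_move st q v : phase1_inv st -> ~~ eligible l (grp st q) ->
  v \in grp st q -> pillar (grp st q) v -> phase1_inv (move1 st q v (Phase1 _ _)).
Proof.
move=> [size_res le_grp] inel_q v_q /eqP pil_v.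
have l_gt1 := ineligible_gt1 inel_q; split; first by rewrite /=; nia.
move=> q' s el_s le_T w; rewrite /= /upd.
case: eqP => [eq_q|_]; last exact: le_grp.
subst q'; have {}le_grp := le_grp q s el_s le_T.
rewrite hv_rem; case: eqP => [<-{w}|_]; last by rewrite subn0.
(* Otherwise [h s = h Q] for an eligible [s] inside the ineligible [Q]. *)
rewrite leqNgt; apply/negP => gt_v.
have le_h : h (grp st q) <= h s by move: gt_v (leq_hv_h s v); lia.
have le_size : size s <= size (grp st q) by apply: leq_size_counts.
move: inel_q el_s; rewrite /eligible -ltnNge => inel_q el_s.
by nia.
Qed.

(** The groups of a feasible solution are eligible, so the current groups dominate them pointwise
    and R lies inside R'. Then [h (Rsa st) <= h R'], and eligibility of R' gives the lower bound. *)
Lemma phase1_end st : conserved T st -> phase1_inv st ->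
  (forall q, q \in classes T -> eligible l (grp st q)) ->
  [/\ all_eligible st, approx st & lower_bound (h (Rsa st))].
Proof.
move=> cons_st [size_res le_grp] el_cl.
have le_R g R' : feasible l T g R' ->
    forall q v, count_mem (q, v) (res st) <= count_mem (q, v) R'.
  move=> feas q v; have eq_T := feasible_count q v feas.
  move: (cons_st q v) eq_T.
  case: (boolP (q \in classes T)) => [q_T|/count_notin_classes->]; last by lia.
  rewrite mul1n => eq1 eq2; case: feas => permT [/(_ q q_T) el_g _].
  suff : hv (g q) v <= hv (grp st q) v by lia.
  apply: le_grp => // w; move/permP: permT => ->.
  rewrite count_cat count_flatten_tag ?classes_uniq // q_T mul1n.
  exact: leq_addl.
split=> [q|g R' feas|g R' feas].
- have [/el_cl //|q_T] := boolP (q \in classes T).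
  by rewrite (conserved_grp_nil cons_st q_T) /eligible /h big_nil muln0.
- apply: leq_trans size_res _; rewrite leq_mul2l; apply/orP; right.
  by apply: leq_size_counts => -[q v]; apply: le_R feas q v.
have [_ [_ el_R]] := feas.
rewrite -(size_map snd); apply: leq_trans el_R; rewrite leq_mul2l; apply/orP; right.
(* Heights count SA values whereas [le_R] compares tuples, so the tuples with value [v] are filtered
   out and compared one by one. *)
apply: leq_size_h => v; rewrite /hv /Rsa !count_map -!size_filter.
apply: leq_size_counts => -[q w]; rewrite !count_filter.
have [<-|ne_wv] := eqVneq w v.
  rewrite !(eq_count (a1 := predI _ _) (a2 := pred1 (q, w))).
  - exact: le_R feas q w.
  - by move=> [q' w'] /=; rewrite xpair_eqE; case: (w' =P w); rewrite ?andbT ?andbF.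
  by move=> [q' w'] /=; rewrite xpair_eqE; case: (w' =P w); rewrite ?andbT ?andbF.
rewrite (eq_count (a2 := pred0)) ?count_pred0 // => -[q' w'] /=.
by rewrite xpair_eqE; case: (w' =P w) => [->|]; rewrite ?andbF //= (negPf ne_wv) andbF.
Qed.

(** * Moves after Phase One, and Phase Two *)

Lemma approx_move m st st' : lower_bound m -> ~~ eligible l (Rsa st) ->
  h (Rsa st) <= (l - 1) * m -> size (res st') <= size (res st) + l -> approx st'.
Proof.
move=> low_m inel_R le_h le_size g R' /low_m le_m.
have l_gt1 := ineligible_gt1 inel_R; have h_gt := ineligible_h_gt0 inel_R.
move: inel_R; rewrite /eligible -ltnNge size_map => inel_R.
(* Ineligibility gives |R| < l * (l - 1) * m; a positive [m] leaves room for [l] more tuples below l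
   * l * m. *)
have m_gt : 0 < m by move: le_h; case: (m); lia.
apply: (@leq_trans (l * (l * m))); last by rewrite leq_mul2l le_m orbT.
have : l * h (Rsa st) <= l * ((l - 1) * m) by rewrite leq_mul2l le_h orbT.
suff : l * ((l - 1) * m) + l <= l * (l * m) by lia.
by rewrite -mulnSr leq_mul2l -addn1; apply/orP; right; nia.
Qed.

Lemma all_eligible_upd st st' q s : grp st' = upd (grp st) q s ->
  all_eligible st -> eligible l s -> all_eligible st'.
Proof. by move=> eq_g el_st el_s q'; rewrite eq_g /upd; case: eqP. Qed.

Lemma alive_nonempty st q : 0 < h (Rsa st) -> alive l st q -> grp st q != [::].
Proof. by move=> R_gt alive_q; apply/eqP => /(dead_nil l R_gt)/alive_q. Qed.

Lemma phase2_nonpillar st v q : all_eligible st -> ~~ eligible l (Rsa st) ->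
  (forall w, alive_val l T st w -> hv (Rsa st) v <= hv (Rsa st) w) ->
  q \in classes T -> alive l st q -> ~~ pillar (Rsa st) v.
Proof.
move=> el_st inel_R min_v q_T alive_q.
have [w w_q w_R] := eligible_notin (el_st q)
  (alive_nonempty (ineligible_h_gt0 inel_R) alive_q) (ineligible_pillars inel_R).
have {}min_v : hv (Rsa st) v <= hv (Rsa st) w.
  by apply: min_v; exists q; rewrite ?hv_gt0.
apply/pillarPn; apply: (leq_ltn_trans min_v); apply/pillarPn.
apply: contra w_R => pil_w.
by rewrite mem_pillars pil_w (pillar_mem (ineligible_h_gt0 inel_R)).
Qed.

Lemma nonconflicting_pillars st q : ~ conflicting st q ->
  {in pillars (grp st q), forall v, ~~ pillar (Rsa st) v}.
Proof.
move=> noconf v; rewrite mem_pillars => /andP[_ pil_v].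
by apply/negP => pil_R; apply: noconf; exists v.
Qed.

Lemma thin_alive_nonconflicting st q :
  thin l (grp st q) -> alive l st q -> ~ conflicting st q.
Proof. by move=> thin_q alive_q conf_q; apply: alive_q. Qed.

(** * Phase Three *)

Lemma late_height_bound m r : 1 < l -> r <= m -> m + (l - 2) * r <= (l - 1) * m.
Proof.
move=> l_gt1 le_rm; have -> : l - 1 = (l - 2).+1 by lia.
by rewrite mulSn leq_add2l leq_mul2l le_rm orbT.
Qed.

Lemma level_le_h m r st : 1 < l -> r <= m -> level m r st ->
  h (Rsa st) <= (l - 1) * m.
Proof.
by move=> l_gt1 le_rm [le_h _]; apply: leq_trans le_h _; apply: late_height_bound.
Qed.

Lemma heights_le_size st : conserved T st -> all_eligible st ->
  l * heights T st + size (Rsa st) <= size T.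
Proof.
move=> cons_st el_st; rewrite (conserved_size cons_st) addnC leq_add2l.
by rewrite /heights big_distrr leq_sum //= => q _; apply: el_st.
Qed.

Lemma all_dead_size st : conserved T st -> dead_off st [::] ->
  size T = size (Rsa st) + l * heights T st.
Proof.
move=> cons_st dead_st; rewrite (conserved_size cons_st); congr (_ + _).
rewrite /heights big_distrr; apply: eq_big_seq => q /dead_st[//|/eqP-> _] //.
Qed.

(** When all groups are dead, ineligibility of R reads [size T < l * (h (Rsa st) + heights T st)];
    with the second clause of [level] this leaves l * r < l * m. *)
Lemma level_lt m r st : conserved T st -> dead_off st [::] ->
  ~~ eligible l (Rsa st) -> level m r st -> r < m.
Proof.
move=> cons_st dead_st; rewrite /eligible -ltnNge => inel_R [_].
rewrite (all_dead_size cons_st dead_st); nia.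
Qed.

(** If some [v] in [P] were a pillar of every group, its multiplicity in T would be h(R) plus all
    group heights. Eligibility of T, whose groups are all thin, would then make R eligible. *)
Lemma greedy_shrinks st P : eligible l (map snd T) -> conserved T st ->
  dead_off st [::] -> ~~ eligible l (Rsa st) -> {subset P <= Rpillars st} ->
  P != [::] -> exists2 q, q \in classes T & size (CP st q P) < size P.
Proof.
move=> el_T cons_st dead_st inel_R sub_P P_n0.
have [v v_P] : exists v, v \in P
  by case: P P_n0 {sub_P} => [//|v P]; exists v; rewrite mem_head.
have [/hasP[q q_T nonpil]|/hasPn all_pil] :=
  boolP (has (fun q => ~~ pillar (grp st q) v) (classes T)).
  exists q => //; rewrite size_filter.
  rewrite -(count_predC (fun v => pillar (grp st q) v && pillar (Rsa st) v) P).
  rewrite -[X in X < _]addn0 ltn_add2l -has_count; apply/hasP; exists v => //=.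
  by rewrite (negPf nonpil).
have pil_R : pillar (Rsa st) v by have := sub_P v v_P; rewrite mem_filter => /andP[].
have hv_T : hv (map snd T) v = h (Rsa st) + heights T st.
  rewrite (conserved_hv v cons_st) (eqP pil_R); congr (_ + _).
  by apply: eq_big_seq => q /all_pil/negPn/eqP.
have := leq_hv_h (map snd T) v; move: el_T inel_R.
rewrite /eligible size_map (all_dead_size cons_st dead_st) hv_T -ltnNge => el_T inel_R le_h.
have : l * (h (Rsa st) + heights T st) <= l * h (map snd T).
  by rewrite leq_mul2l le_h orbT.
lia.
Qed.

Lemma greedy_step st P S q : eligible l (map snd T) -> conserved T st ->
  dead_off st [::] -> ~~ eligible l (Rsa st) -> P != [::] -> q \in classes T ->
  (forall q', q' \in classes T -> size (CP st q P) <= size (CP st q' P)) ->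
  greedy_inv st P S ->
  size (CP st q P) < size P /\ greedy_inv st (CP st q P) (q :: S).
Proof.
move=> el_T cons_st dead_st inel_R P_n0 q_T min_q [sub_P lt_l S_ok cover].
have lt_P : size (CP st q P) < size P.
  have [q' q'_T lt_q'] := greedy_shrinks el_T cons_st dead_st inel_R sub_P P_n0.
  exact: leq_ltn_trans (min_q q' q'_T) lt_q'.
split=> //; split.
- by move=> w; rewrite mem_filter => /andP[_ /sub_P].
- by move: lt_l lt_P => /=; lia.
- move=> q'; rewrite inE => /predU1P[->|/S_ok //]; split=> //.
  (* An empty group has every value as a pillar, so choosing it would not shrink [P]. *)
  apply: contraTneq lt_P => q_nil; rewrite -leqNgt size_filter.
  rewrite (eq_in_count (a2 := predT)) ?count_predT // => w /sub_P /=.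
  by rewrite mem_filter q_nil pillar_nil => /andP[-> _].
move=> w pil_w; case: (cover w pil_w) => [w_P|[q' q'_S nonpil]]; last first.
  by right; exists q' => //; rewrite inE q'_S orbT.
have [pil_q|nonpil] := boolP (pillar (grp st q) w).
  by left; rewrite mem_filter pil_q pil_w.
by right; exists q => //; rewrite mem_head.
Qed.

(** R has a pillar, and once [P] is exhausted some chosen group must have excluded it. *)
Lemma greedy_end_nonempty st S : 0 < h (Rsa st) -> greedy_inv st [::] S -> S != [::].
Proof.
move=> /pillar_exists[w _ pil_w] [_ _ _ /(_ w pil_w)[//|[q]]].
by case: S.
Qed.

Lemma greedy_end m r st S S' : ~~ eligible l (Rsa st) -> dead_off st [::] ->
  r < m -> level m r st -> greedy_inv st [::] S -> perm_eq S' (undup S) ->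
  move_inv m st S'.
Proof.
move=> inel_R dead_st lt_rm [le_h le_sum] gr_S perm_S.
have S_n0 := greedy_end_nonempty (ineligible_h_gt0 inel_R) gr_S.
have [_ lt_l S_ok cover] := gr_S.
have mem_S' : S' =i S by move=> q; rewrite (perm_mem perm_S) mem_undup.
have S'_gt : 0 < size S'.
  by case: (S) S_n0 mem_S' => [//|q S1] _ /(_ q); rewrite mem_head; case: (S').
have S'_lt : size S' < l.
  by rewrite (perm_size perm_S) (leq_ltn_trans (size_undup _)) // -[size S]addn0.
(* A pillar of R is missed by some group of [S'], so it gains at most |S'| - 1 copies; a nonpillar
   may gain |S'| but starts lower. Since |S'| < l, the rise is at most l - 2. *)
exists (h (Rsa st) + (size S').-1), r; split=> //.
- by move: le_h S'_lt S'_gt; nia.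
- have -> : h (Rsa st) + (size S').-1 + heights T st + r.+1 =
            h (Rsa st) + heights T st + r + size S' by lia.
  by rewrite mulnDr leq_add2r.
- split; first by rewrite (perm_uniq perm_S) undup_uniq.
  move=> q; rewrite mem_S' => /S_ok[q_T q_n0]; split=> //.
  by have [] := dead_st q q_T isT.
move=> w; have [pil_w|/pillarPn lt_w] := boolP (pillar (Rsa st) w); last first.
  by have := count_size (fun q => pillar (grp st q) w) S'; lia.
have [//|[q q_S nonpil]] := cover w pil_w.
rewrite leq_add ?leq_hv_h // -ltnS prednK //.
rewrite -(count_predC (fun q => pillar (grp st q) w)) -[X in X < _]addn0.
by rewrite ltn_add2l -has_count; apply/hasP; exists q; rewrite ?mem_S'.
Qed.

(** The height of [q] drops by at least one, which pays for the [l] lost when [q] leaves the pending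
    list. *)
Lemma move_step m st q S : move_inv m st (q :: S) ->
  move_inv m (movep st q (Phase3Move V S)) S.
Proof.
move=> [b [r [lt_rm le_b le_sum [/= /andP[q_S uniq_S] S_ok] le_w]]].
have [q_T q_n0 thin_q] := S_ok q (mem_head _ _).
have h_gt : 0 < h (grp st q) by rewrite h_gt0.
exists b, r; split=> //.
- have := heights_upd (st' := movep st q (Phase3Move V S)) q_T erefl.
  have := h_strip h_gt; rewrite /strip; move: le_sum => /=.
  move: (heights T _) (heights T _) (h _) (h _) => H' H k k'.
  by rewrite mulnSr => le_sum lt_k eq_H; nia.
- split=> // q' q'_S; rewrite /= /upd.
  case: (q' =P q) q'_S => [->|_ q'_S]; first by rewrite (negPf q_S).
  by apply: S_ok; rewrite inE q'_S orbT.
move=> w; apply: leq_trans (le_w w); rewrite Rsa_movep hv_cat /=.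
rewrite [hv (pillars _) w](count_uniq_mem _ (pillars_uniq _)).
(* The pending list has no duplicates, so its other groups are untouched; a copy gained by [w] was
   already counted through [q]. *)
have -> : count (fun q' => pillar (upd (grp st) q (strip (grp st q)) q') w) S =
          count (fun q' => pillar (grp st q') w) S.
  apply: eq_in_count => q' q'_S; rewrite /upd; case: eqP => // eq_q.
  by rewrite -eq_q q'_S in q_S.
rewrite mem_pillars; case: (w \in _) => /=; lia.
Qed.

Lemma move_size m st q S : ~~ eligible l (Rsa st) -> move_inv m st (q :: S) ->
  h (Rsa st) <= (l - 1) * m.
Proof.
move=> /ineligible_gt1 l_gt1 [b [r [lt_rm le_b _ _ le_w]]].
apply: (@leq_trans b); last first.
  exact: leq_trans le_b (late_height_bound l_gt1 lt_rm).
by apply/h_leqP => w; apply: leq_trans (le_w w); apply: leq_addr.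
Qed.

(** The list [p] of moved values is kept general to cover both a single fat move and a thin move of
    all pillars. *)
Lemma dead_off_movement st st' q A p s : grp st' = upd (grp st) q s ->
  Rsa st' = p ++ Rsa st -> uniq p -> {in p, forall v, ~~ pillar (Rsa st) v} ->
  dead_off st (q :: A) -> dead_off st' (q :: A).
Proof.
move=> eq_g eq_R uniq_p p_nonpil dead_st q' q'_T q'_A.
apply: (dead_persists (st := st)); last exact: dead_st.
- by rewrite eq_g /upd; move: q'_A; rewrite inE; case: eqP.
- by rewrite eq_R h_cat_nonpillars.
by move=> v; rewrite eq_R hv_cat leq_addl.
Qed.

Lemma level_movement m r st st' q p s : q \in classes T ->
  grp st' = upd (grp st) q s -> h s <= h (grp st q) ->
  Rsa st' = p ++ Rsa st -> uniq p -> {in p, forall v, ~~ pillar (Rsa st) v} ->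
  level m r st -> level m r st'.
Proof.
move=> q_T eq_g le_s eq_R uniq_p p_nonpil [le_h le_sum].
have eq_h : h (Rsa st') = h (Rsa st) by rewrite eq_R h_cat_nonpillars.
rewrite /level eq_h; split=> //; apply: leq_trans le_sum; rewrite leq_mul2l.
by have := heights_upd q_T eq_g; lia.
Qed.

Lemma h_strip_le (s : seq V) : h (strip s) <= h s.
Proof.
by apply: leq_size_h => v; rewrite hv_strip leq_subr.
Qed.

(** * Preservation of the invariant by every step *)

Lemma inv_step st st' : eligible l (map snd T) -> run_inv st -> step l T st st' ->
  run_inv st'.
Proof.
move=> el_T inv_st step_st; case: step_st inv_st => {st st'}.
- move=> st q v ctl_st q_T inel_q v_q pil_v [cons_st]; rewrite ctl_st => inv1.
  by split; [apply: conserved_move1 | apply: phase1_move].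
- move=> st ctl_st el_cl [cons_st]; rewrite ctl_st => inv1; split=> //=.
  have [el_st app low] := phase1_end cons_st inv1 el_cl.
  (* The height of R at this moment is the [m] of all later phases. *)
  by split=> //; exists (h (Rsa st)); last exact: leqnn.
- move=> st nctl1 _ el_R [cons_st inv_st]; split=> //=.
  suff [el_st app [m low_m _]] : [/\ all_eligible st, approx st &
      exists2 m, lower_bound m & late_inv m st] by split=> //; exists m.
  by case ctl_st: (ctl st) inv_st.
- move=> st v q ctl_st inel_R _ min_v q_T alive_q v_gt fat_q [cons_st].
  rewrite ctl_st => -[el_st app [m low_m]]; rewrite /late_inv ctl_st => le_m.
  have v_q : v \in grp st q by rewrite -hv_gt0.
  have l_gt1 := ineligible_gt1 inel_R.
  have nonpil := phase2_nonpillar el_st inel_R min_v q_T alive_q.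
  split; first exact: conserved_move1.
  split; first exact: all_eligible_upd (fat_rem fat_q v_q).
    by apply: (approx_move low_m inel_R) => /=; nia.
  exists m => //; rewrite /late_inv /= -[Rsa _]/([:: v] ++ Rsa st) h_cat_nonpillars //.
  by move=> w; rewrite inE => /eqP->.
- move=> st v q ctl_st inel_R _ min_v q_T alive_q v_gt thin_q [cons_st].
  rewrite ctl_st => -[el_st app [m low_m]]; rewrite /late_inv ctl_st => le_m.
  have l_gt1 := ineligible_gt1 inel_R.
  have h_gt : 0 < h (grp st q) by apply: leq_trans v_gt (leq_hv_h _ _).
  split; first exact: conserved_movep.
  split; first exact: all_eligible_upd (eligible_strip thin_q).
    apply: (approx_move low_m inel_R); first by nia.
    by rewrite /= size_cat size_map addnC leq_add2l thin_pillars.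
  exists m => //; rewrite /late_inv /= Rsa_movep h_cat_nonpillars ?pillars_uniq //.
  exact/nonconflicting_pillars/thin_alive_nonconflicting.
- move=> st ctl_st inel_R no_alive [cons_st].
  rewrite ctl_st => -[el_st app [m low_m]]; rewrite /late_inv ctl_st => le_m.
  split=> //; split=> //; exists m => //; split.
    (* No round is complete yet, and eligibility of the groups gives
       [l * heights T st <= size T]. *)
    exists 0 => //; split; rewrite ?muln0 ?addn0 // mulnDr leq_add //.
      by rewrite leq_mul2l le_m orbT.
    exact: leq_trans (leq_addr _ _) (heights_le_size cons_st el_st).
  move=> q q_T _; have R_gt := ineligible_h_gt0 inel_R.
  case: (dead_dec l q R_gt) => // alive_q; have := alive_nonempty R_gt alive_q.
  rewrite -h_gt0 => /pillar_exists[v v_q _]; case: (no_alive v).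
  by exists q; rewrite ?hv_gt0.
- move=> st ctl_st inel_R [cons_st].
  rewrite ctl_st => -[el_st app [m low_m]]; rewrite /late_inv ctl_st.
  move=> [[r le_rm lev] dead_st]; split=> //; split=> //; exists m => //; split=> //.
    by exists r => //; apply: level_lt lev.
  split=> // [|w pil_w]; first exact: ineligible_pillars.
  by left; rewrite mem_pillars pil_w (pillar_mem (ineligible_h_gt0 inel_R)).
- move=> st P S q ctl_st inel_R P_n0 q_T min_q [cons_st].
  rewrite ctl_st => -[el_st app [m low_m]]; rewrite /late_inv ctl_st.
  move=> [lev dead_st gr]; split=> //; split=> //; exists m => //; split=> //.
  by have [] := greedy_step el_T cons_st dead_st inel_R P_n0 q_T min_q gr.
- move=> st S S' ctl_st inel_R perm_S [cons_st].
  rewrite ctl_st => -[el_st app [m low_m]]; rewrite /late_inv ctl_st.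
  move=> [[r lt_rm lev] dead_st gr]; split=> //; split=> //; exists m => //.
  exact: greedy_end lt_rm lev gr perm_S.
- move=> st q S ctl_st inel_R [cons_st].
  rewrite ctl_st => -[el_st app [m low_m]]; rewrite /late_inv ctl_st => mv.
  have [_ [_ [_ _ _ [_ /(_ q (mem_head _ _))[q_T q_n0 thin_q]] _]]] := mv.
  split; first exact: conserved_movep.
  split; first exact: all_eligible_upd (eligible_strip thin_q).
    apply: (approx_move low_m inel_R); first exact: move_size mv.
    by rewrite /= size_cat size_map addnC leq_add2l thin_pillars ?h_gt0.
  by exists m => //; apply: move_step.
- move=> st A ctl_st inel_R uniq_A A_alive [cons_st].
  rewrite ctl_st => -[el_st app [m low_m]]; rewrite /late_inv ctl_st.
  move=> [b [r [lt_rm le_b le_sum _ le_w]]].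
  (* With no move pending, [b] bounds h(R) itself, and the round counts as completed. *)
  have le_h : h (Rsa st) <= b by apply/h_leqP => w; have := le_w w; rewrite addn0.
  split=> //; split=> //; exists m => //; split.
  + exists r.+1 => //; split; first exact: leq_trans le_b.
    rewrite muln0 addn0 in le_sum; apply: leq_trans le_sum; rewrite leq_mul2l.
    by rewrite -!addnA leq_add2r le_h orbT.
  + by move=> q /A_alive[].
  move=> q q_T q_A; case: (dead_dec l q (ineligible_h_gt0 inel_R)) => // alive_q.
  by case/negP: q_A; apply/A_alive.
- move=> st q A v ctl_st inel_R alive_q fat_q v_q nonpil [cons_st].
  rewrite ctl_st => -[el_st app [m low_m]]; rewrite /late_inv ctl_st.
  move=> [[r le_rm lev] sub_A dead_st].
  have l_gt1 := ineligible_gt1 inel_R.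
  have nonpils : {in [:: v], forall w, ~~ pillar (Rsa st) w}.
    by move=> w; rewrite inE => /eqP->.
  split; first exact: conserved_move1.
  split; first exact: all_eligible_upd (fat_rem fat_q v_q).
    by apply: (approx_move low_m inel_R) => /=; [exact: level_le_h lev | lia].
  exists m => //; split=> //; last first.
    exact: (dead_off_movement (st := st) (p := [:: v])) dead_st.
  exists r => //; apply: (level_movement (st := st) (p := [:: v])) lev => //.
    by apply: sub_A; rewrite mem_head.
  exact: h_rem.
- move=> st q A ctl_st inel_R alive_q thin_q noconf [cons_st].
  rewrite ctl_st => -[el_st app [m low_m]]; rewrite /late_inv ctl_st.
  move=> [[r le_rm lev] sub_A dead_st].
  have l_gt1 := ineligible_gt1 inel_R.
  have nonpils := nonconflicting_pillars noconf.
  have q_n0 := alive_nonempty (ineligible_h_gt0 inel_R) alive_q.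
  split; first exact: conserved_movep.
  split; first exact: all_eligible_upd (eligible_strip thin_q).
    apply: (approx_move low_m inel_R); first exact: level_le_h lev.
    by rewrite /= size_cat size_map addnC leq_add2l thin_pillars ?h_gt0.
  exists m => //; split=> //; last first.
    exact: dead_off_movement (Rsa_movep _ _ _) (pillars_uniq _) nonpils dead_st.
  exists r => //.
  apply: level_movement (Rsa_movep _ _ _) (pillars_uniq _) nonpils lev => //.
    by apply: sub_A; rewrite mem_head.
  exact: h_strip_le.
- move=> st q A ctl_st inel_R dead_q [cons_st].
  rewrite ctl_st => -[el_st app [m low_m]]; rewrite /late_inv ctl_st.
  move=> [lev sub_A dead_st].
  split=> //; split=> //; exists m => //; split=> // [q' q'_A|q' q'_T q'_A].
    by apply: sub_A; rewrite inE q'_A orbT.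
  have [->|ne_q] := eqVneq q' q; first exact: dead_q.
  by apply: dead_st; rewrite ?inE ?negb_or ?ne_q.
- move=> st ctl_st inel_R [cons_st].
  rewrite ctl_st => -[el_st app [m low_m]]; rewrite /late_inv ctl_st.
  by move=> [lev _ dead_st]; split=> //; split=> //; exists m.
Qed.

Lemma reachable_inv st : eligible l (map snd T) -> reachable l T st -> run_inv st.
Proof.
move=> el_T; elim=> [|st1 st2 _ inv_st1]; first exact: inv_init.
exact: inv_step.
Qed.

End Invariant.

(** * Termination *)

Section Termination.
Variables (Q V : eqType) (l : nat) (T : seq (Q * V)).
Hypothesis el_T : eligible l (map snd T).
Implicit Types (st : state Q V) (q : Q) (v w : V).

(* A nonempty [Phase3Move] ranks below [Phase3Start] and [Phase3Move [::]]
   above it: every round enlarges R between the two, so the return to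
   [Phase3Start] never has to be compared with the previous one. *)
Definition rank st :=
  match ctl st with
  | Done => 0
  | Phase3Move (_ :: _) => 1
  | Phase3Greedy P _ => 2 + size P
  | Phase3Start => 3 + size (res st)
  | Phase3Step2 A => 4 + size (res st) + size A
  | Phase3Move [::] => 5 + size (res st) + size (classes T)
  | Phase2 => 4 + size (res st)
  | Phase1 => 5 + size (res st)
  end.

Lemma size_movep st q c : grp st q != [::] ->
  size (res st) < size (res (movep st q c)).
Proof.
move=> q_n0; rewrite /= size_cat size_map -[X in X < _]add0n ltn_add2r.
by rewrite size_pillars_gt0.
Qed.

(** A lexicographic measure: R never shrinks and is bounded by T, and [rank] falls whenever R keeps
    its size. *)
Lemma step_decreases st st' : run_inv l T st -> step l T st st' ->
  size (res st) < size (res st') \/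
  size (res st') = size (res st) /\ rank st' < rank st.
Proof.
move=> inv_st step_st; case: step_st inv_st => {st st'}.
- by left.
- by move=> st ctl_st _ _; right; rewrite /rank ctl_st.
- move=> st _ ctl_st _ _; right; split=> //; rewrite /rank /=.
  by case: (ctl st) ctl_st => // -[].
- by left.
- move=> st v q _ _ _ _ _ _ v_gt _ _; left; apply: size_movep.
  by rewrite -h_gt0; apply: leq_trans v_gt (leq_hv_h _ _).
- by move=> st ctl_st _ _ _; right; rewrite /rank ctl_st.
- move=> st ctl_st _ _; right; rewrite /rank ctl_st; split=> //=.
  rewrite !addSn !ltnS -(size_map snd (res st)) size_filter.
  exact: leq_trans (count_size _ _) (size_undup _).
- move=> st P S q ctl_st inel_R P_n0 q_T min_q [cons_st].
  rewrite ctl_st => -[el_st app [m low_m]]; rewrite /late_inv ctl_st.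
  move=> [lev dead_st gr]; right; rewrite /rank ctl_st; split=> //=.
  by have [] := greedy_step el_T cons_st dead_st inel_R P_n0 q_T min_q gr.
- move=> st S S' ctl_st inel_R perm_S [cons_st].
  rewrite ctl_st => -[el_st app [m low_m]]; rewrite /late_inv ctl_st.
  move=> [lev dead_st gr]; right; rewrite /rank ctl_st; split=> //=.
  (* A nonempty [S] yields a nonempty move list, of rank 1, below the rank 2 of the greedy loop with
     [P] empty. *)
  have S_n0 := greedy_end_nonempty (ineligible_h_gt0 inel_R) gr.
  case: S' perm_S => // /perm_size/esym/eqP; rewrite size_eq0 => /eqP/undup_nil S0.
  by rewrite S0 in S_n0.
- move=> st q S ctl_st inel_R [cons_st].
  rewrite ctl_st => -[el_st app [m low_m]]; rewrite /late_inv ctl_st => mv.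
  have [_ [_ [_ _ _ [_ /(_ q (mem_head _ _))[q_T q_n0 thin_q]] _]]] := mv.
  by left; apply: size_movep.
- move=> st A ctl_st _ uniq_A A_alive _; right; rewrite /rank ctl_st; split=> //=.
  have : size A <= size (classes T) by apply: uniq_leq_size => // q /A_alive[].
  by lia.
- by left.
- move=> st q A _ inel_R alive_q _ _ _; left.
  by apply: size_movep; apply: (alive_nonempty (ineligible_h_gt0 inel_R)) alive_q.
- by move=> st q A ctl_st _ _ _; right; rewrite /rank ctl_st /=; split=> //; lia.
- by move=> st ctl_st _ _; right; rewrite /rank ctl_st /=; split=> //; lia.
Qed.

Lemma reachable_Acc st : reachable l T st ->
  Acc (fun st1 st2 => step l T st2 st1) st.
Proof.
move: {2}(size T - size (res st)) (erefl (size T - size (res st))) => a.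
elim/ltn_ind: a st => a IHa st; move: {2}(rank st) (erefl (rank st)) => b.
elim/ltn_ind: b st => b IHb st eq_b eq_a reach; constructor => st' step_st.
have reach' : reachable l T st' by apply: r_step step_st.
have := conserved_size_res (reachable_inv el_T reach').1.
have := step_decreases (reachable_inv el_T reach) step_st.
case=> [lt_size le_T|[eq_size lt_rank] _].
  by apply: IHa (erefl _) reach'; lia.
by apply: IHb (erefl _) _ reach'; rewrite -?eq_b // eq_size.
Qed.

Lemma no_infinite_run : ~ exists f : nat -> state Q V,
  f 0 = init T /\ forall n, step l T (f n) (f n.+1).
Proof.
move=> [f [f0 step_f]].
have no_run st : Acc (fun st1 st2 => step l T st2 st1) st -> forall n, f n <> st.
  by elim=> {}st _ IH n eq_st; apply: (IH (f n.+1) _ n.+1 erefl); rewrite -eq_st.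
by apply: (no_run (f 0) _ 0 erefl); rewrite f0; apply/reachable_Acc/r_init.
Qed.

(** * Progress: some step is possible until termination *)

Lemma fat_nonpillar st q : ~~ eligible l (Rsa st) -> fat l (grp st q) ->
  exists2 v, v \in grp st q & ~~ pillar (Rsa st) v.
Proof.
move=> inel_R fat_q.
have el_q : eligible l (grp st q) by move: fat_q; rewrite /fat /eligible; lia.
have q_n0 : grp st q != [::].
  by apply: contraTneq fat_q => ->; rewrite /fat addn1 ltn0.
have [v v_q v_R] := eligible_notin el_q q_n0 (ineligible_pillars inel_R).
exists v => //; apply: contra v_R => pil_v.
by rewrite mem_pillars pil_v (pillar_mem (ineligible_h_gt0 inel_R)).
Qed.

Lemma filter_alive st : 0 < h (Rsa st) -> exists2 A : seq Q,
  uniq A & forall q, q \in A <-> q \in classes T /\ alive l st q.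
Proof.
move=> R_gt; exists [seq q <- classes T | ~~ dead_dec l q R_gt].
  by rewrite filter_uniq ?classes_uniq.
move=> q; rewrite mem_filter andbC.
by case: (dead_dec l q R_gt) => [dead_q|alive_q] /=;
  rewrite ?andbT ?andbF; split=> // -[].
Qed.

Lemma phase2_progress st : ctl st = Phase2 Q V -> ~~ eligible l (Rsa st) ->
  all_eligible l st -> exists st', step l T st st'.
Proof.
move=> ctl_st inel_R el_st.
have [A _ A_alive] := filter_alive (ineligible_h_gt0 inel_R).
(* A finite list of the alive values, over which a least frequent one can be chosen. *)
pose vals := flatten [seq grp st q | q <- A].
have vals_alive v : v \in vals <-> alive_val l T st v.
  split=> [/flatten_mapP[q /A_alive[q_T alive_q] v_q]|[q q_T [alive_q v_gt]]].
    by exists q; rewrite ?hv_gt0.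
  by apply/flatten_mapP; exists q; [apply/A_alive | rewrite -hv_gt0].
have [no_vals|vals_n0] := eqVneq vals [::].
  eexists; apply: s_p2_end => // v /vals_alive.
  by rewrite no_vals.
have [v /vals_alive alive_v min_v] := seq_argmin (hv (Rsa st)) vals_n0.
have {}min_v w : alive_val l T st w -> hv (Rsa st) v <= hv (Rsa st) w.
  by move/vals_alive; apply: min_v.
have [q q_T [alive_q v_gt]] := alive_v.
have [thin_q|fat_q] := orP (eligible_thin_fat (el_st q)); eexists.
  exact: s_p2_thin ctl_st inel_R alive_v min_v q_T alive_q v_gt thin_q.
exact: s_p2_fat ctl_st inel_R alive_v min_v q_T alive_q v_gt fat_q.
Qed.

Lemma progress st : run_inv l T st -> ctl st <> Done Q V -> exists st', step l T st st'.
Proof.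
move=> [cons_st inv_st] nDone.
have [ctl_st|nPhase1] : ctl st = Phase1 Q V \/ ctl st <> Phase1 Q V.
- by case: (ctl st); [left | right..].
- have [/allP el_cl|/allPn[q q_T inel_q]] :=
    boolP (all (fun q => eligible l (grp st q)) (classes T)).
    by eexists; apply: s_p1_end.
  have [v v_q pil_v] := pillar_exists (ineligible_h_gt0 inel_q).
  by eexists; apply: s_p1_move pil_v.
have [el_R|inel_R] := boolP (eligible l (Rsa st)).
  by eexists; apply: s_done.
have [el_st [m late_st]] : all_eligible l st /\ exists m, late_inv l T m st.
  by case ctl_st: (ctl st) inv_st => // -[el_st _ [m _ late_st]]; split=> //; exists m.
have R_gt := ineligible_h_gt0 inel_R.
rewrite /late_inv in late_st.
case ctl_st: (ctl st) late_st => [|||P S|[|q S]|[|q A]|] // late_st.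
- exact: phase2_progress.
- by eexists; apply: s_p3_start.
- have [P0|P_n0] := eqVneq P [::].
    rewrite P0 in ctl_st; eexists.
    exact: (s_p3_greedy_end T ctl_st inel_R (perm_refl _)).
  (* The argmin needs at least one class; the group that shrinks [P] is one. *)
  have cl_n0 : classes T != [::].
    have [_ dead_st [sub_P _ _ _]] := late_st.
    by have [q] := greedy_shrinks el_T cons_st dead_st inel_R sub_P P_n0; case: (classes T).
  have [q q_T min_q] := seq_argmin (fun q => size (CP st q P)) cl_n0.
  by eexists; exact: s_p3_greedy ctl_st inel_R P_n0 q_T min_q.
- have [A uniq_A A_alive] := filter_alive R_gt.
  by eexists; exact: s_p3_step2 ctl_st inel_R uniq_A A_alive.
- by eexists; exact: s_p3_move ctl_st inel_R.
- by eexists; exact: s_p3_round ctl_st inel_R.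
case: (dead_dec l q R_gt) => [dead_q|alive_q].
  by eexists; exact: s_p3_next ctl_st inel_R dead_q.
have [thin_q|fat_q] := orP (eligible_thin_fat (el_st q)).
  eexists; apply: (s_p3_thin T ctl_st inel_R alive_q thin_q).
  exact: thin_alive_nonconflicting thin_q alive_q.
have [v v_q nonpil] := fat_nonpillar inel_R fat_q.
by eexists; exact: s_p3_fat ctl_st inel_R alive_q fat_q v_q nonpil.
Qed.

End Termination.

Theorem theorem3 (Q V : eqType) (l : nat) (T : seq (Q * V))
  (HT : eligible l (map snd T)) :
  (* every run terminates (no infinite execution, whatever the tie-breaking) *)
  (~ exists f : nat -> state Q V,
       f 0 = init T /\ forall n, step l T (f n) (f n.+1)) /\
  (* the algorithm never gets stuck before terminating *)
  (forall st, reachable l T st -> ctl st <> Done Q V ->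
      exists st', step l T st st') /\
  (* every output is feasible and within factor l of OPT *)
  (forall st, reachable l T st -> ctl st = Done Q V ->
      feasible l T (grp st) (res st) /\
      (forall g R', feasible l T g R' -> size (res st) <= l * size R')).
Proof.
split; first exact: no_infinite_run.
split=> st reach ctl_st; have inv_st := reachable_inv HT reach.
  exact: progress.
have [cons_st] := inv_st.
rewrite ctl_st => -[el_st app [m _]]; rewrite /late_inv ctl_st => el_R.
split=> //; split; first exact: conserved_perm.
by split=> // q _; apply: el_st.
Qed.
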